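(* Let $X$ be a metrizable topological space, let $G$ be a finitely generated transformation group of homeomorphisms of $X$ (i.e. a finitely generated group, under composition, of homeomorphisms of $X$ onto itself), and let $h_1,\ldots,h_p$ be generators of $G$. Let $S = \{h_1,\ldots,h_p, \mathrm{id}, h_1^{-1},\ldots,h_p^{-1}\}$, where $\mathrm{id}$ is the identity map of $X$, and for each $g \in G\setminus\{\mathrm{id}\}$ let $m(g)$ be the least natural number $n$ such that $g$ can be expressed as the product (composition) of $n$ elements of $S$. Then there exists a metric $d$ on $X$, compatible with the topology of $X$, such that each $g \in G\setminus\{\mathrm{id}\}$ satisfies the Lipschitz condition with respect to $d$ with a constant not greater than $\log(m(g)+2)$; that is, $d(g(x),g(y)) \leq \log(m(g)+2)\, d(x,y)$ for all $x,y \in X$.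
   Context: A metric on a metrizable space $X$ is compatible if it induces the given topology of $X$. $\log$ denotes the natural logarithm. *)

(* Defs.v *)
From mathcomp Require Import all_boot all_order all_algebra.
From mathcomp Require Import all_classical all_reals all_analysis.

Set Implicit Arguments.
Unset Strict Implicit.
Unset Printing Implicit Defensive.

Import Order.TTheory GRing.Theory Num.Theory.
Local Open Scope classical_set_scope.
Local Open Scope ring_scope.

(* The library's [metricType] bundles a metric with its own topology; here the
   topology of [X] is given first, so metrics on [X] are unbundled functions
   subject to the axioms of the factory [isMetric]. *)
Record is_metric (R : realType) (X : Type) (d : X -> X -> R) : Prop := {
  metric_refl : forall x, d x x = 0 ;
  metric_positivity : forall x y, d x y = 0 -> x = y ;
  metric_symmetry : forall x y, d x y = d y x ;
  metric_triangle_ineq : forall x y z, d x z <= d x y + d y z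
}.

Definition compatible_metric (R : realType) (X : topologicalType)
    (d : X -> X -> R) : Prop :=
  is_metric d /\
  forall A : set X, open A <->
    forall x, A x -> exists2 e : R, 0 < e & [set y | d x y < e] `<=` A.

Definition metrizable (R : realType) (X : topologicalType) : Prop :=
  exists d : X -> X -> R, compatible_metric d.

Definition homeomorphism (X : topologicalType) (f : X -> X) : Prop :=
  exists g : X -> X,
    [/\ cancel f g, cancel g f, continuous f & continuous g].

Record transformation_group (X : topologicalType) (G : set (X -> X)) : Prop := {
  tgroup_homeo : forall g, G g -> homeomorphism g ;
  tgroup_id : G (@idfun X) ;
  tgroup_comp : forall f g, G f -> G g -> G (f \o g) ;
  tgroup_inv : forall g g', G g -> cancel g g' -> cancel g' g -> G g'
}.

Definition generates (X : topologicalType) (p : nat) (h : 'I_p -> X -> X)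
    (G : set (X -> X)) : Prop :=
  smallest (@transformation_group X) (range h) = G.

(* The set S = {h_1, ..., h_p, id, h_1^-1, ..., h_p^-1}. *)
Definition symmetric_gens (X : Type) (p : nat) (h : 'I_p -> X -> X) :
    set (X -> X) :=
  range h `|` [set @idfun X]
  `|` [set s | exists i, cancel (h i) s /\ cancel s (h i)].

Definition is_product (X : Type) (S : set (X -> X)) (n : nat) (g : X -> X) :
    Prop :=
  exists2 w : 'I_n -> X -> X,
    forall i, S (w i) & g = \big[comp/@idfun X]_(i < n) w i.

(* The value m(g).  It is 0 if [g] is not a product of generators, which does
   not occur for [g] in the group.  The empty product (n = 0) is the identity,
   so for [g] other than the identity it is immaterial whether the least [n]
   is sought from 0 or from 1. *)
Definition word_length (X : Type) (p : nat) (h : 'I_p -> X -> X) (g : X -> X) :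
    nat :=
  xget 0%N [set n | is_product (symmetric_gens h) n g /\
    forall k, is_product (symmetric_gens h) k g -> (n <= k)%N].

(* Main.v *)
Require Import Defs.
From mathcomp Require Import all_boot all_order all_algebra.
From mathcomp Require Import all_classical all_reals all_analysis.
From mathcomp Require Import lra.

(** If [d0 <= 1] is a compatible metric and [W_n] is the (finite) set of products
    of [n] letters of [S], put
      [d x y = sup_n sup_(g in W_n) d0 (g x) (g y) / ln (n + c)].
    Since [1 / ln (n + c)] tends to [0], only finitely many homeomorphisms matter
    up to a given error, so [d] is compatible.  If [g] is in [W_m], then
    [W_n \o g] lies in [W_(n + m)], so [g] is Lipschitz with any constant bounding
    all the ratios [ln (n + m + c) / ln (n + c)]; as [e < 3], a large [c] makes
    these ratios at most [ln (m + 2)] for all [n >= 0] and [m >= 1]. *)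

Set Implicit Arguments.
Unset Strict Implicit.

Import Order.TTheory GRing.Theory Num.Theory.
Local Open Scope classical_set_scope.
Local Open Scope ring_scope.

(** * Numerical estimates for the logarithm *)

Section Logarithm.
Variable R : realType.
Implicit Types (A b : R).

Lemma expR1_lt3 : expR 1 < 3 :> R.
Proof.
(* Sixth power of [1 - 1/6 <= exp (-1/6)]; the exponent 6 suffices because [(5/6)^6 > 1/3]. *)
have h : (5 / 6) ^+ 6 <= expR (- (1 / 6)) ^+ 6 :> R.
  apply: lerXn2r; rewrite ?nnegrE ?expR_ge0//.
  by apply: le_trans (expR_ge1Dx _); lra.
rewrite -expRM_natl in h.
rewrite (_ : 6%:R * - (1 / 6) = -1 :> R) in h; last by lra.
rewrite expRN in h.
have e0 := expR_gt0 (1 : R).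
rewrite -[3]invrK -[expR 1]invrK ltf_pV2 ?posrE ?invr_gt0 ?ltr0n//.
by apply: lt_le_trans h; lra.
Qed.

Lemma ln3_gt1 : 1 < ln 3 :> R.
Proof. by rewrite -ltr_expR lnK ?posrE ?ltr0n ?expR1_lt3. Qed.

(* With [L = ln (b + 2)], it suffices that [ln A + L <= L * ln A], that is,
   [1 <= (L - 1) * (ln A - 1)]. *)
Lemma lnD_le_mul A b : expR (1 + (ln 3 - 1)^-1) <= A -> 1 <= b ->
  ln (A + b) <= ln (b + 2) * ln A.
Proof.
move=> hA b1; have l3 := ln3_gt1.
have d0 : 0 < ln 3 - 1 :> R by lra.
have A1 : 1 <= A.
  apply: le_trans hA; apply: le_trans (expR_ge1Dx _).
  by rewrite lerDl addr_ge0// invr_ge0 ltW.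
have hlA : 1 + (ln 3 - 1)^-1 <= ln A.
  by rewrite -ler_expR lnK// posrE; lra.
have hL : ln 3 <= ln (b + 2) by rewrite ler_ln ?posrE; lra.
have hs : ln (A + b) <= ln A + ln (b + 2).
  by rewrite -lnM ?posrE ?ler_ln ?posrE; nra.
have : 1 <= (ln (b + 2) - 1) * (ln A - 1).
  apply: (@le_trans _ _ ((ln 3 - 1) / (ln 3 - 1))); first by rewrite divff ?lt0r_neq0.
  by apply: ler_pM; rewrite ?invr_ge0 ?(ltW d0) ?lerD2r// lerBrDl.
nra.
Qed.

End Logarithm.

(** * Compatibility in terms of neighbourhoods, and truncation of a metric *)

Section CompatibleMetric.
Variables (R : realType) (X : topologicalType).
Implicit Types (d : X -> X -> R).

Lemma metric_ge0 d x y : is_metric d -> 0 <= d x y.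
Proof.
move=> md; have := metric_triangle_ineq md x y x.
by rewrite metric_refl// (metric_symmetry md y x); lra.
Qed.

Lemma compatible_nbhs d x (A : set X) : compatible_metric d ->
  nbhs x A <-> exists2 e : R, 0 < e & [set y | d x y < e] `<=` A.
Proof.
move=> [md od]; split=> [|[e e0 eA]].
  rewrite nbhsE => -[U [oU Ux] UA].
  by have [e e0 eU] := (od U).1 oU x Ux; exists e => // y /eU/UA.
rewrite nbhsE; exists [set y | d x y < e] => //; split; last first.
  by rewrite /= metric_refl.
apply/od => y /= xy; exists (e - d x y); first by rewrite subr_gt0.
move=> z /= yz; have := metric_triangle_ineq md x y z; lra.
Qed.

Lemma compatible_of_nbhs d : is_metric d ->
  (forall x (A : set X),
    nbhs x A <-> exists2 e : R, 0 < e & [set y | d x y < e] `<=` A) ->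
  compatible_metric d.
Proof.
move=> md nd; split=> // A; rewrite openE; split=> [oA x Ax|oA x Ax].
  exact/nd/oA.
exact/nd/oA.
Qed.

(** Truncating at 1 keeps all balls of radius at most 1. The bound is what makes the supremum below
    finite and its tail small. *)
Lemma compatible_le1 d : compatible_metric d ->
  exists2 d' : X -> X -> R, compatible_metric d' & forall x y, d' x y <= 1.
Proof.
move=> cd; have md := cd.1; have d0 x y := metric_ge0 x y md.
exists (fun x y => Num.min (d x y) 1); last by move=> x y; rewrite ge_min lexx orbT.
have dmin x y (e : R) : e <= 1 -> (Num.min (d x y) 1 < e) = (d x y < e).
  by move=> e1; rewrite gt_min ltNge [1 < e]ltNge e1 orbF -ltNge.
apply: compatible_of_nbhs.
  split=> [x|x y|x y|x y z].
  - by rewrite metric_refl// min_l.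
  - case: (leP (d x y) 1) => _; first exact: metric_positivity.
    by move=> /eqP; rewrite oner_eq0.
  - by rewrite (metric_symmetry md).
  - have := metric_triangle_ineq md x y z; have := d0 x y; have := d0 y z.
    by case: (leP (d x y) 1); case: (leP (d y z) 1); case: (leP (d x z) 1); lra.
move=> x A; apply: iff_trans (compatible_nbhs x A cd) _; split=> -[e e0 eA].
  exists (Num.min e 1); first by rewrite lt_min e0 ltr01.
  move=> y /=; rewrite dmin ?ge_min ?lexx ?orbT// lt_min => /andP[ye _].
  exact: eA.
exists (Num.min e 1); first by rewrite lt_min e0 ltr01.
move=> y /=; rewrite lt_min => /andP[ye y1]; apply: eA => /=.
by rewrite gt_min ye.
Qed.

End CompatibleMetric.

(** * Words in a set of maps *)

Section Products.
Variables (X : Type) (S : set (X -> X)).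
Implicit Types (f g s : X -> X) (n m : nat).

Lemma is_product0 g : is_product S 0 g <-> g = idfun.
Proof.
split=> [[w _ ->]|->]; first by rewrite big_ord0.
by exists (fun=> idfun) => [[]//|]; rewrite big_ord0.
Qed.

Lemma is_productS n g : is_product S n.+1 g <->
  exists s f, [/\ S s, is_product S n f & g = s \o f].
Proof.
split=> [[w Sw ->]|[s [f [Ss [w Sw ->] ->]]]].
  exists (w ord0), (\big[comp/idfun]_(i < n) w (lift ord0 i)).
  by split=> //; [exists (fun i => w (lift ord0 i))|rewrite big_ord_recl].
exists (fun i => if unlift ord0 i is Some j then w j else s).
  by move=> i; case: unliftP => [j|] _.
rewrite big_ord_recl unlift_none; congr comp.
by apply: eq_bigr => i _; rewrite liftK.
Qed.

Lemma is_product1 s : S s -> is_product S 1 s.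
Proof. by move=> Ss; apply/is_productS; exists s, idfun; split=> //; apply/is_product0. Qed.

Lemma is_product_comp m n f g : is_product S m f -> is_product S n g ->
  is_product S (m + n) (f \o g).
Proof.
move=> + Wg; elim: m f => [|m IH] f; first by move=> /is_product0 ->.
move=> /is_productS[s [f' [Ss Wf' ->]]]; rewrite addSn.
by apply/is_productS; exists s, (f' \o g); split=> //; exact: IH.
Qed.

(** Isolates the letter that acts first on points, where [is_productS] isolates the one that acts
    last. *)
Lemma is_productSr n g : is_product S n.+1 g ->
  exists f s, [/\ is_product S n f, S s & g = f \o s].
Proof.
elim: n g => [|n IH] g /is_productS[s [f [Ss Wf ->]]].
  move/is_product0: Wf => ->; exists idfun, s; split=> //; exact/is_product0.
have [f' [s' [Wf' Ss' ->]]] := IH f Wf.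
by exists (s \o f'), s'; split=> //; apply/is_productS; exists s, f'.
Qed.

(** If [g'] inverts [s \o f], then [g' \o s] inverts [f]; induction applies to it, and [s'] is
    appended on the right. *)
Lemma is_product_inv n g g' :
  (forall s s', S s -> cancel s s' -> cancel s' s -> S s') ->
  (forall s, S s -> exists2 s', cancel s s' & cancel s' s) ->
  is_product S n g -> cancel g g' -> cancel g' g -> is_product S n g'.
Proof.
move=> Sinv Sbij; elim: n g g' => [|n IH] g g'.
  move=> /is_product0 -> g1 _; apply/is_product0/funext => x; exact: g1.
move=> /is_productS[s [f [Ss Wf ->]]] gK g'K.
have [s' sK s'K] := Sbij s Ss.
have Wf' : is_product S n (g' \o s).
  apply: IH Wf _ _ => x /=; first exact: gK.
  by apply: (can_inj sK); exact: (g'K (s x)).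
rewrite (_ : g' = (g' \o s) \o s'); last by apply/funext => x /=; rewrite s'K.
rewrite -addn1; apply: is_product_comp => //.
exact/is_product1/(Sinv s).
Qed.

End Products.

(** * The group as the set of words in its generators *)

Section Generators.
Variables (X : topologicalType) (G : set (X -> X)).
Hypothesis groupG : transformation_group G.
Variables (p : nat) (h : 'I_p -> X -> X).
Hypothesis genG : generates h G.
Let S := symmetric_gens h.

Lemma gens_in_group i : G (h i).
Proof. by rewrite -genG; apply: sub_gen_smallest; exists i. Qed.

Lemma symmetric_gens_in_group s : S s -> G s.
Proof.
case=> [[[i _ <-]|->]|[i [hs sh]]].
- exact: gens_in_group.
- exact: tgroup_id.
- exact: (tgroup_inv groupG (gens_in_group i) hs sh).
Qed.

Lemma symmetric_gens_inv s s' : S s -> cancel s s' -> cancel s' s -> S s'.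
Proof.
have canE (f f1 f2 : X -> X) : cancel f f1 -> cancel f2 f -> f1 = f2.
  by move=> K1 K2; apply/funext => x; rewrite -[in LHS](K2 x) K1.
case=> [[[i _ <-]|->]|[i [hs sh]]] sK s'K.
- by right; exists i.
- by left; right; exact: (canE idfun).
- by left; left; exists i => //; symmetry; exact: (canE s).
Qed.

Lemma finite_symmetric_gens : finite_set S.
Proof.
rewrite /S /symmetric_gens !finite_setU; do !split; try exact: finite_set1.
  exact: finite_image.
(* A two-sided inverse is unique, so choosing one for each index reaches every inverse; the default
   [idfun] only enlarges the range. *)
have inv_sub : [set s | exists i, cancel (h i) s /\ cancel s (h i)] `<=`
    range (fun i : 'I_p => xget (@idfun X) [set s | cancel (h i) s /\ cancel s (h i)]).
  move=> s [i [hs sh]]; exists i => //.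
  case: xgetP => [t _ [ht th]|/(_ s)[]//].
  by apply/funext => x; rewrite -[in LHS](sh x) ht.
by apply: sub_finite_set inv_sub _; exact: finite_image.
Qed.

(** [G] is the smallest transformation group containing the generators, so it suffices that the
    words form one. *)
Lemma group_is_product g : G g -> exists n, is_product S n g.
Proof.
rewrite -{1}genG; have Sid : S idfun by left; right.
have homeoS s : S s -> homeomorphism s.
  by move=> /symmetric_gens_in_group; exact: tgroup_homeo.
(* Words lie in [G], which supplies the homeomorphism clause. *)
have WG n f : is_product S n f -> G f.
  elim: n f => [|n IH] f.
    by move=> /is_product0 ->; exact: tgroup_id.
  move=> /is_productS[s [f' [Ss Wf' ->]]].
  by apply: tgroup_comp => //; [exact: symmetric_gens_in_group|exact: IH].
apply: (smallest_sub (X := [set g | exists n, is_product S n g])); last first.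
  by move=> _ [i _ <-]; exists 1%N; apply: is_product1; left; left; exists i.
split=> [f [n /WG]||f1 f2 [n W1] [m W2]|f f' [n Wf] fK f'K].
- exact: tgroup_homeo.
- by exists 0%N; apply/is_product0.
- by exists (n + m)%N; exact: is_product_comp.
- exists n; apply: (is_product_inv _ _ Wf fK f'K); first exact: symmetric_gens_inv.
  by move=> s /homeoS[s' [sK s'K _ _]]; exists s'.
Qed.

(** A shortest word exists by well-ordering, so [xget] returns its length and not the default 0. *)
Lemma word_lengthP g : G g -> is_product S (word_length h g) g.
Proof.
move=> /group_is_product[n Wn].
suff : [set n | is_product S n g /\ forall k, is_product S k g -> (n <= k)%N]
    (word_length h g) by case.
apply: xgetPex.
have ex : exists n, `[< is_product S n g >] by exists n; apply/asboolP.
exists (ex_minn ex); case: ex_minnP => m /asboolP Wm minm; split=> // k Wk.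
by apply/minm/asboolP.
Qed.

(** With [P] a bound on a distance, this is equicontinuity of the words of length [n]. Continuity of
    the letter [s] acting first moves the base point to [s x], and finiteness of [S] allows the
    intersection over all [s]. *)
Lemma near_products (P : X -> X -> Prop) n x :
  (forall z, \forall y \near z, P z y) ->
  \forall y \near x, forall g, is_product S n g -> P (g x) (g y).
Proof.
move=> nearP; elim: n x => [|n IH] x.
  by apply: filterS (nearP x) => y Py g /is_product0 ->.
have near_s s : S s ->
    \forall y \near x, forall f, is_product S n f -> P (f (s x)) (f (s y)).
  move=> /symmetric_gens_in_group/(tgroup_homeo groupG)[_ [_ _ cs _]].
  exact: (cs x _ (IH (s x))).
have [D SD] := finite_fsetP.1 finite_symmetric_gens.
pose U s := [set y | forall f, is_product S n f -> P (f (s x)) (f (s y))].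
have : nbhs x (\bigcap_(s in S) U s).
  by rewrite SD; apply: filter_bigI => s sD; apply: near_s; rewrite SD.
apply: filterS => y Dy g /is_productSr[f [s [Wf Ss ->]]].
exact: (Dy s Ss).
Qed.

End Generators.

(** * The supremum metric for abstract weights [c] *)

Section WeightedSupMetric.
Variables (R : realType) (X : topologicalType) (S : set (X -> X)).
Variables (c : nat -> R) (d0 : X -> X -> R).
Hypothesis c_ge1 : forall n, 1 <= c n.
Hypothesis cd0 : compatible_metric d0.
Hypothesis d0_le1 : forall x y, d0 x y <= 1.

Definition sup_metric_values (x y : X) : set R :=
  [set r | exists n g, is_product S n g /\ r = d0 (g x) (g y) / c n].

Definition sup_metric (x y : X) : R := sup (sup_metric_values x y).

Let md0 : is_metric d0 := cd0.1.
Let c_gt0 n : 0 < c n. Proof. exact: lt_le_trans (c_ge1 n). Qed.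

Lemma ler_sup_metric n g x y : is_product S n g ->
  d0 (g x) (g y) / c n <= sup_metric x y.
Proof.
move=> Wg; apply: ub_le_sup; last by exists n, g.
exists 1 => _ [m [f [_ ->]]].
by rewrite ler_pdivrMr// mul1r (le_trans (d0_le1 _ _)).
Qed.

Lemma sup_metric_ler x y r :
  (forall n g, is_product S n g -> d0 (g x) (g y) / c n <= r) ->
  sup_metric x y <= r.
Proof.
move=> hr; apply: ge_sup => [|_ [n [g [Wg ->]]]]; last exact: hr.
by exists (d0 x y / c 0%N), 0%N, idfun; split=> //; apply/is_product0.
Qed.

(** The term of the empty word. It gives separation of points and one of the two comparisons of
    topologies. *)
Lemma ler_sup_metric0 x y : d0 x y <= c 0%N * sup_metric x y.
Proof.
rewrite mulrC -ler_pdivrMr//.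
by apply: (@ler_sup_metric 0%N idfun); apply/is_product0.
Qed.

Lemma sup_metric_is_metric : is_metric sup_metric.
Proof.
split=> [x|x y xy|x y|x y z].
- apply/eqP; rewrite eq_le; apply/andP; split.
    by apply: sup_metric_ler => n g _; rewrite metric_refl// mul0r.
  have := ler_sup_metric0 x x.
  by rewrite metric_refl// pmulr_rge0.
- have := ler_sup_metric0 x y; rewrite xy mulr0 => xy0.
  by apply: (metric_positivity md0); have := metric_ge0 x y md0; lra.
- congr sup; apply/seteqP; split=> _ [n [g [Wg ->]]]; exists n, g;
    by rewrite (metric_symmetry md0).
- apply: sup_metric_ler => n g Wg.
  apply: le_trans (lerD (ler_sup_metric x y Wg) (ler_sup_metric y z Wg)).
  by rewrite -mulrDl ler_pM2r ?invr_gt0// metric_triangle_ineq.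
Qed.

Lemma sup_metric_compatible :
  (forall n x (P : X -> X -> Prop), (forall z, \forall y \near z, P z y) ->
    \forall y \near x, forall g, is_product S n g -> P (g x) (g y)) ->
  (forall M : R, exists N, forall n, (N <= n)%N -> M <= c n) ->
  compatible_metric sup_metric.
Proof.
move=> nearW c_infty; apply: (compatible_of_nbhs sup_metric_is_metric) => x A.
split=> [/(compatible_nbhs _ _ cd0)[e e0 eA]|[e e0 eA]].
  exists (e / c 0%N) => [|y /=]; first by rewrite divr_gt0.
  rewrite ltr_pdivlMr// mulrC => xy; apply: eA.
  exact: le_lt_trans (ler_sup_metric0 x y) xy.
(* A supremum of terms is bounded only non-strictly, hence the margin [e / 2]. *)
have e20 : 0 < e / 2 by lra.
have [N cN] := c_infty (e / 2)^-1.
have near_z z : \forall y \near z, d0 z y <= e / 2.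
  apply/(compatible_nbhs _ _ cd0); exists (e / 2) => // y /=.
  exact: ltW.
have : \forall y \near x, forall n : 'I_N, forall g, is_product S n g ->
    d0 (g x) (g y) <= e / 2.
  by apply: filter_forall => n; exact: (nearW n x (fun a b => d0 a b <= e / 2)).
apply: filterS => y hy; apply: eA => /=.
apply: (@le_lt_trans _ _ (e / 2)); last by lra.
apply: sup_metric_ler => n g Wg; rewrite ler_pdivrMr//.
(* Short words are controlled by the neighbourhood, since dividing by [c n >= 1] only shrinks; long
   ones by [d0 <= 1] and the size of [c n]. *)
case: (ltnP n N) => [nN|Nn].
  apply: le_trans (hy (Ordinal nN) g Wg) _.
  by rewrite ler_peMr// ltW.
apply: le_trans (d0_le1 _ _) _.
by rewrite mulrC -ler_pdivrMr// mul1r; exact: cN.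
Qed.

(** The term of [f] at [g x], [g y] is the term of [f \o g] at [x], [y] times [c (n + m) / c n], a
    ratio at most [L]. *)
Lemma sup_metric_lipschitz m g (L : R) x y : is_product S m g ->
  (forall n, c (n + m)%N <= L * c n) ->
  sup_metric (g x) (g y) <= L * sup_metric x y.
Proof.
move=> Wg cL; have L0 : 0 <= L.
  by rewrite -(pmulr_lge0 _ (c_gt0 0%N)) (le_trans _ (cL 0%N))// ltW.
apply: sup_metric_ler => n f Wf.
have Wfg := is_product_comp Wf Wg.
apply: le_trans (ler_wpM2l L0 (ler_sup_metric x y Wfg)).
rewrite [leRHS]mulrCA; apply: ler_wpM2l; first exact: metric_ge0.
by rewrite ler_pdivlMr// mulrC ler_pdivrMr.
Qed.

End WeightedSupMetric.

Theorem theorem1p3 (R : realType) (X : topologicalType)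
    (metrizableX : metrizable R X)
    (G : set (X -> X)) (groupG : transformation_group G)
    (p : nat) (h : 'I_p -> X -> X) (genG : generates h G) :
  exists d : X -> X -> R, compatible_metric d /\
    forall g : X -> X, G g -> g <> @idfun X ->
      forall x y : X, d (g x) (g y) <= ln ((word_length h g + 2)%:R) * d x y.
Proof.
have [d1 /compatible_le1[d0 cd0 d0_le1]] := metrizableX.
(* The threshold of [lnD_le_mul]; as [ln K >= 1], it also makes every weight at least 1. *)
pose K : R := expR (1 + (ln 3 - 1)^-1).
pose c (n : nat) : R := ln (n%:R + K).
have K_gt0 : 0 < K by exact: expR_gt0.
have K_le (n : nat) : K <= n%:R + K by rewrite lerDr.
have c_ge1 n : 1 <= c n.
  apply: (@le_trans _ _ (ln K)).
    by rewrite expRK lerDl invr_ge0 subr_ge0 ltW// ln3_gt1.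
  by rewrite ler_ln ?posrE// (lt_le_trans K_gt0).
exists (sup_metric (symmetric_gens h) c d0); split.
  apply: sup_metric_compatible => // [n x P|M].
    exact: (near_products groupG genG).
  (* [n >= exp M] already gives [ln (n + K) >= M]. *)
  exists (Num.bound (expR M)) => n Nn.
  rewrite -ler_expR lnK ?posrE ?(lt_le_trans K_gt0)//.
  have := archi_boundP (expR_ge0 M).
  have : (Num.bound (expR M))%:R <= n%:R :> R by rewrite ler_nat.
  lra.
move=> g Gg g_neq x y; have Wg := word_lengthP groupG genG Gg.
apply: (sup_metric_lipschitz _ _ _ _ _ Wg) => // n.
(* [lnD_le_mul] is used with [A = n + K] and [b] the word length. *)
rewrite /c natrD addrAC natrD; apply: lnD_le_mul => //.
(* The requirement [1 <= b] is where [g] must differ from the identity: length 0 means the empty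
   word. *)
rewrite ler1n lt0n; apply/eqP => m0; apply: g_neq.
by rewrite m0 in Wg; exact: (is_product0 _ _).1 Wg.
Qed.
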